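(* Let $p$ be a prime and $n \geq 1$ an integer. Let $L_n$ denote the linear subspace of $\mathbb{F}_p[x_1,\ldots,x_n]$ spanned by the monomials $\prod_{i=1}^n x_i^{\alpha_i}$ with $0 \leq \alpha_i < p$ for all $i$, and for an integer $d$ let $L_{n,d}$ denote the subspace of $L_n$ spanned by those monomials of (total) degree at most $d$. Let $\{(a_i,b_i)\}_{i=1}^m$ be a perfectly matched sequence in $\mathbb{F}_p^n$, with target set $T = \{a_i+b_i \mid i=1,\ldots,m\}$. Then $|T| \leq 3 \dim L_{n,d}$, where $d = \lfloor \frac13 (p-1) n \rfloor$.
   Context: A perfectly matched sequence in an abelian group $H$ is a sequence of ordered pairs $\{(a_i,b_i)\}_{i=1}^m$ in $H^2$ such that the equation $a_i+b_i = a_j+b_k$ (with $i,j,k \in \{1,\ldots,m\}$) has no solutions with $j \neq k$. Its target set is $T = \{a_i+b_i \mid i = 1,\ldots,m\}$. *)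

(* Defs.v *)
From HB Require Import structures.
From mathcomp Require Export all_boot all_order all_algebra.
From mathcomp Require Export mpoly.

Set Implicit Arguments.
Unset Strict Implicit.
Unset Printing Implicit Defensive.

Import GRing.Theory.
Local Open Scope ring_scope.

Definition perfectly_matched (H : zmodType) (m : nat) (s : 'I_m -> H * H) :
    Prop :=
  forall i j k : 'I_m, (s i).1 + (s i).2 = (s j).1 + (s k).2 -> j = k.

Definition target_set (H : finZmodType) (m : nat) (s : 'I_m -> H * H) :
    {set H} :=
  [set (s i).1 + (s i).2 | i : 'I_m].

Section ReducedPolynomials.

Variables p n : nat.

Definition Ln_exp (alpha : {ffun 'I_n -> 'I_p}) : 'X_{1..n} :=
  [multinom (alpha i : nat) | i < n].

(* Being spanned by the monomials with all exponents less than p is expressed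
   on the support; Ln_predP gives the description as a span. *)
Definition Ln_pred : {pred {mpoly 'F_p[n]}} :=
  [pred f | all (fun m : 'X_{1..n} => [forall i, (m i < p)%N]) (msupp f)].

Lemma Ln_mcoeff0 (f : {mpoly 'F_p[n]}) (m : 'X_{1..n}) :
  f \in Ln_pred -> ~~ [forall i, (m i < p)%N] -> f@_m = 0.
Proof.
move=> /allP fP; apply: contraNeq; rewrite -mcoeff_msupp; exact: fP.
Qed.

Lemma Ln_pred_coeff (f : {mpoly 'F_p[n]}) :
  (forall m : 'X_{1..n}, ~~ [forall i, (m i < p)%N] -> f@_m = 0) ->
  f \in Ln_pred.
Proof.
move=> f0; apply/allP => m; rewrite mcoeff_msupp.
by apply: contraNT => /f0 ->.
Qed.

Lemma Ln_pred_submod : submod_closed Ln_pred.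
Proof.
split=> [|c f g fP gP]; apply: Ln_pred_coeff => m mP; first by rewrite mcoeff0.
by rewrite mcoeffD mcoeffZ !(Ln_mcoeff0 _ mP) // mulr0 addr0.
Qed.

HB.instance Definition _ :=
  GRing.isSubmodClosed.Build 'F_p {mpoly 'F_p[n]} Ln_pred Ln_pred_submod.

Record Ln := MkLn { mpoly_of_Ln :> {mpoly 'F_p[n]}; _ : mpoly_of_Ln \in Ln_pred }.

HB.instance Definition _ := [isSub for mpoly_of_Ln].
HB.instance Definition _ := [Choice of Ln by <:].
HB.instance Definition _ := [SubChoice_isSubLmodule of Ln by <:].

Lemma Ln_exp_inj : injective Ln_exp.
Proof.
move=> a b /mnmP eq_ab; apply/ffunP => i; apply/val_inj.
by have := eq_ab i; rewrite !mnmE.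
Qed.

Lemma Ln_monom_subproof (alpha : {ffun 'I_n -> 'I_p}) :
  'X_[Ln_exp alpha] \in Ln_pred.
Proof. by rewrite inE msuppX /= andbT; apply/forallP => i; rewrite mnmE. Qed.

Lemma Ln_expand (f : {mpoly 'F_p[n]}) : f \in Ln_pred ->
  f = \sum_alpha f@_(Ln_exp alpha) *: 'X_[Ln_exp alpha].
Proof.
move=> fP; apply/mpolyP => m; rewrite raddf_sum /=.
have [/forallP mP|mP] := boolP [forall i, (m i < p)%N]; last first.
  rewrite (Ln_mcoeff0 fP mP) big1 // => alpha _; rewrite mcoeffZ mcoeffX.
  case: eqP => [E|_]; last by rewrite mulr0.
  by rewrite E (Ln_mcoeff0 fP mP) mul0r.
have Em : m = Ln_exp [ffun i => Ordinal (mP i)].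
  by apply/mnmP => i; rewrite mnmE ffunE.
rewrite {1 2}Em (bigD1 [ffun i => Ordinal (mP i)]) //=.
rewrite mcoeffZ mcoeffX eqxx mulr1 big1 ?addr0 // => b neq.
by rewrite mcoeffZ mcoeffX (inj_eq Ln_exp_inj) (negPf neq) mulr0.
Qed.

Lemma Ln_predP (f : {mpoly 'F_p[n]}) :
  f \in Ln_pred <-> exists c : {ffun 'I_n -> 'I_p} -> 'F_p,
    f = \sum_alpha c alpha *: 'X_[Ln_exp alpha].
Proof.
split=> [/Ln_expand fE|[c ->]]; first by exists (fun a => f@_(Ln_exp a)).
by apply: rpred_sum => a _; apply: rpredZ; apply: Ln_monom_subproof.
Qed.

Lemma Ln_vect_axiom : Vector.axiom #|{ffun 'I_n -> 'I_p}| Ln.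
Proof.
exists (fun f : Ln => \row_k (f : {mpoly 'F_p[n]})@_(Ln_exp (enum_val k))).
  by move=> c f g; apply/rowP => k; rewrite !mxE /= mcoeffD mcoeffZ.
have gP (r : 'rV['F_p]_#|{ffun 'I_n -> 'I_p}|) :
    \sum_alpha r 0 (enum_rank alpha) *: 'X_[Ln_exp alpha] \in Ln_pred.
  by apply/Ln_predP; exists (fun a => r 0 (enum_rank a)).
exists (fun r => MkLn (gP r)) => [[f fP]|r].
  apply/val_inj; rewrite /= [RHS](Ln_expand fP).
  by apply: eq_bigr => a _; rewrite mxE enum_rankK.
apply/rowP => k; rewrite mxE /= raddf_sum /= (bigD1 (enum_val k)) //=.
rewrite mcoeffZ mcoeffX eqxx mulr1 enum_valK big1 ?addr0 // => b neq.
by rewrite mcoeffZ mcoeffX (inj_eq Ln_exp_inj) (negPf neq) mulr0.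
Qed.

HB.instance Definition _ := Lmodule_hasFinDim.Build 'F_p Ln Ln_vect_axiom.

Definition Ln_monom (alpha : {ffun 'I_n -> 'I_p}) : Ln :=
  MkLn (Ln_monom_subproof alpha).

Definition Lnd (d : nat) : {vspace Ln} :=
  <<[seq Ln_monom alpha |
      alpha <- enum {ffun 'I_n -> 'I_p} & (mdeg (Ln_exp alpha) <= d)%N]>>%VS.

End ReducedPolynomials.

(* Main.v *)
From HB Require Import structures.
Require Import Defs.
From mathcomp Require Import all_field zify.

(** Croot-Lev-Pach polynomial method. Among the functions on F_p^n given by
    reduced polynomials of degree at most 2d+1, those vanishing outside T form a
    space of dimension at least |T| minus the number of reduced monomials of
    degree greater than 2d+1; reversing exponents (alpha_i to p-1-alpha_i), that
    number is at most dim L_{n,d}. Pick such an f whose support is at least as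
    large as this dimension. As the sequence is perfectly matched, the matrix
    f(a_j + b_k), indexed by the support of f, is diagonal and invertible. But
    every monomial of f(x + y) has degree at most d in x or in y, so the rank of
    the matrix is at most 2 dim L_{n,d}. *)

Set Implicit Arguments.
Unset Strict Implicit.
Unset Printing Implicit Defensive.

Import GRing.Theory.
Local Open Scope ring_scope.

(** * Dimension counts, and supports of functions on a finite set *)

(** Each discarded vector of a spanning family costs at most one dimension, so no linear
    independence is required. *)
Lemma leq_dim_span_filter (K : fieldType) (vT : vectType K) (I : finType)
    (v : I -> vT) (P : pred I) :
    (forall u, exists c : I -> K, u = \sum_i c i *: v i) ->
  (\dim {:vT} <= \dim <<[seq v i | i <- enum I & P i]>> + #|[pred i | ~~ P i]|)%N.
Proof.
move=> vP; set U := <<_>>%VS.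
pose W := <<[seq v i | i <- enum I & ~~ P i]>>%VS.
have WE : (\dim W <= #|[pred i | ~~ P i]|)%N.
  apply: leq_trans (dim_span _) _; rewrite size_map cardE.
  by rewrite enumT /enum_mem; apply/eq_leq; congr size; apply: eq_filter.
have -> : {:vT}%VS = (U + W)%VS.
  apply/eqP; rewrite eqEsubv subvf andbT; apply/subvP => u _.
  have [c ->] := vP u; apply: memv_suml => i _; apply: memvZ.
  case: (boolP (P i)) => Pi;
    [apply: subvP (addvSl U W) _ _ | apply: subvP (addvSr U W) _ _];
    by apply/memv_span/map_f; rewrite mem_filter Pi mem_enum.
by apply: leq_trans (dimv_add_leqif U W) _; rewrite leq_add2l.
Qed.

Section Functions.

Variables (K : fieldType) (X : finType).
Local Notation FX := {ffun X -> K^o}.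

Definition frestrict (S : {set X}) (f : FX) : FX :=
  [ffun x => if x \in S then f x else 0].

Lemma frestrict_is_linear S : linear (frestrict S).
Proof.
move=> c f g; apply/ffunP => x; rewrite !ffunE.
by case: ifP => // _; rewrite ?scaler0 ?addr0.
Qed.

HB.instance Definition _ S :=
  GRing.isLinear.Build K FX FX _ (frestrict S) (frestrict_is_linear S).

Definition fvanish (S : {set X}) : {vspace FX} := lker (linfun (frestrict S)).

Lemma fvanishP (S : {set X}) (f : FX) :
  reflect (forall x, x \in S -> f x = 0) (f \in fvanish S).
Proof.
rewrite memv_ker lfunE /=; apply: (iffP eqP) => [f0 x xS|f0].
  by move/ffunP/(_ x): f0; rewrite !ffunE xS.
by apply/ffunP => x; rewrite !ffunE; case: ifP => // /f0.
Qed.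

Lemma dim_fullv_ffun : \dim {:FX} = #|X|.
Proof. by rewrite dimvf /dim /= muln1. Qed.

(** Rank-nullity for restriction to [S], whose image is spanned by the indicators of the points of
    [S]. *)
Lemma leq_dim_fvanish (U : {vspace FX}) (S : {set X}) :
  (\dim U <= \dim (U :&: fvanish S) + #|S|)%N.
Proof.
rewrite -(limg_ker_dim (linfun (frestrict S)) U) leq_add2l.
pose delta (y : X) : FX := [ffun x => (x == y)%:R].
apply: (@leq_trans (\dim <<[seq delta y | y <- enum S]>>%VS)); last first.
  by apply: leq_trans (dim_span _) _; rewrite size_map cardE.
apply/dimvS/subvP => _ /memv_imgP[f _ ->]; rewrite lfunE /=.
have -> : frestrict S f = \sum_(y in S) (f y : K) *: delta y.
  apply/ffunP => x; rewrite sum_ffunE ffunE.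
  case: ifP => xS; last first.
    rewrite big1 // => y yS; rewrite !ffunE.
    by case: eqP => [E|_]; rewrite ?scaler0 //; rewrite E yS in xS.
  rewrite (bigD1 x) //= !ffunE eqxx big1 ?addr0 => [|y /andP[_ yx]].
    by rewrite /GRing.scale /= mulr1.
  by rewrite !ffunE eq_sym (negPf yx) scaler0.
apply: memv_suml => y yS; apply: memvZ; apply/memv_span/map_f.
by rewrite mem_enum.
Qed.

(* As long as the support of [f] is smaller than the dimension of [U], a nonzero
   member of [U] vanishing on that support can be added to [f]. *)
Lemma large_support (U : {vspace FX}) :
  exists2 f : FX, f \in U & (\dim U <= #|[set x | f x != 0%R]|)%N.
Proof.
pose supp (f : FX) := [set x | f x != 0].
suff H k : (k <= \dim U)%N -> exists2 f : FX, f \in U & (k <= #|supp f|)%N.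
  exact: H (leqnn _).
elim: k => [_|k IHk lt_k]; first by exists 0; rewrite ?mem0v.
have [f fU] := IHk (ltnW lt_k).
rewrite leq_eqVlt => /predU1P[suppf|]; last by exists f.
have := leq_dim_fvanish U (supp f); rewrite -suppf => le_U.
have nz : (U :&: fvanish (supp f))%VS != 0%VS.
  by apply: contraTneq le_U => ->; rewrite dimv0 add0n -ltnNge.
set g := vpick (U :&: fvanish (supp f)).
have : g \in (U :&: fvanish (supp f))%VS by apply: memv_pick.
rewrite memv_cap => /andP[gU /fvanishP g0].
have [x gx] : exists x, g x != 0.
  apply/existsP; move: nz; rewrite -vpick0; apply: contraNT.
  rewrite negb_exists => /forallP gx0; apply/eqP/ffunP => x.
  by rewrite ffunE; apply/eqP; have := gx0 x; rewrite negbK.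
have fx : x \notin supp f by apply: contraNN gx => /g0 ->.
exists (f + g); first exact: memvD.
apply: (@leq_trans #|x |: supp f|); first by rewrite cardsU1 fx -suppf.
apply/subset_leq_card/subsetP => y; rewrite !inE => /predU1P[->|fy].
  by move: fx; rewrite inE negbK ffunE => /eqP ->; rewrite add0r.
by rewrite ffunE g0 ?addr0 // inE.
Qed.

End Functions.

Arguments fvanish {K X} S.

(** * Reduced monomials as functions on F_p^n *)

Section MonomialFunctions.

Variables p n : nat.
Hypothesis p_prime : prime p.

Local Notation V := 'rV['F_p]_n.
Local Notation FV := {ffun V -> ('F_p)^o}.
Local Notation exps := {ffun 'I_n -> 'I_p}.

Definition exp_le (d : nat) : pred exps := [pred a | (mdeg (Ln_exp a) <= d)%N].

Lemma mdeg_Ln_exp (a : exps) : mdeg (Ln_exp a) = (\sum_i a i)%N.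
Proof. by rewrite mdegE; apply: eq_bigr => i _; rewrite mnmE. Qed.

Definition monom_fun (a : exps) : FV := [ffun x : V => \prod_i x 0 i ^+ a i].

(** The degrees of an exponent vector and of its reversal add up to [(p - 1) * n], so reversal
    injects degrees above [e] into degrees at most [d]. *)
Lemma card_exp_gt_le (d e : nat) : ((p - 1) * n <= d + e.+1)%N ->
  (#|[pred a | ~~ exp_le e a]| <= #|exp_le d|)%N.
Proof.
move=> le_de; pose rev_exp (a : exps) : exps := [ffun i => rev_ord (a i)].
have rev_inj : injective rev_exp.
  by move=> a b /ffunP ab; apply/ffunP => i; have := ab i;
    rewrite !ffunE => /rev_ord_inj.
rewrite -(card_imset _ rev_inj).
apply/subset_leq_card/subsetP => _ /imsetP[a + ->].
rewrite !inE /= -ltnNge !mdeg_Ln_exp => lt_e.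
have : (\sum_i rev_exp a i + \sum_i a i = (p - 1) * n)%N.
  rewrite -big_split /= -[n in RHS]card_ord mulnC -sum_nat_const.
  by apply: eq_bigr => i _; rewrite ffunE; case: (a i) => k lt_kp /=; lia.
move=> sumE; rewrite -(leq_add2r (\sum_i a i)) sumE.
by apply: leq_trans le_de _; rewrite leq_add2l.
Qed.

(** By Fermat's little theorem, [1 - (x - c) ^+ p.-1] is the indicator of [c]; its degree is below
    [p], so only reduced powers occur. *)
Lemma Fp_indicator (c x : 'F_p) :
  \sum_(j < p) (1 - ('X - c%:P) ^+ p.-1)`_j * x ^+ j = (x == c)%:R.
Proof.
have p_gt0 := prime_gt0 p_prime.
rewrite -horner_coef_wide; last first.
  apply: leq_trans (size_polyD _ _) _; rewrite size_polyN size_poly1 geq_max.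
  by rewrite size_exp_XsubC prednK // p_gt0 leqnn.
rewrite !hornerE; case: eqP => [->|/eqP xc].
  (* The exponent [p.-1] must be nonzero here, since [0 ^+ 0] is 1. *)
  rewrite subrr expr0n; have := prime_gt1 p_prime.
  by case: (p) => [|[]] // k _; rewrite subr0.
have xc0 : x - c != 0 by rewrite subr_eq0.
apply/eqP; rewrite subr_eq0 eq_sym; apply/eqP.
apply: (mulfI xc0); rewrite mulr1 -exprS prednK //.
by rewrite -[X in _ ^+ X](card_Fp p_prime) expf_card.
Qed.

(** The indicator of a point is the product of the indicators of its coordinates; distributing that
    product yields one term per exponent vector. *)
Lemma monom_fun_indicator (y x : V) :
  \sum_(a : exps) (\prod_i (1 - ('X - (y 0 i)%:P) ^+ p.-1)`_(a i))
    * monom_fun a x = (x == y)%:R.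
Proof.
transitivity (\prod_i (x 0 i == y 0 i)%:R : 'F_p).
  under [RHS]eq_bigr => i _ do rewrite -Fp_indicator.
  rewrite bigA_distr_bigA; apply: eq_bigr => a _.
  by rewrite ffunE -big_split.
have [->|xy] := eqVneq x y; first by rewrite big1 // => i _; rewrite eqxx.
have [i xyi] : exists i, x 0 i != y 0 i.
  apply/existsP; apply: contraNT xy; rewrite negb_exists => /forallP xyE.
  by apply/eqP/rowP => i; apply/eqP; have := xyE i; rewrite negbK.
by rewrite (bigD1 i) //= (negPf xyi) mul0r.
Qed.

Lemma monom_fun_span (u : FV) :
  exists c : exps -> 'F_p, u = \sum_a c a *: monom_fun a.
Proof.
exists (fun a : exps => \sum_y (u y : 'F_p) *
  \prod_i (1 - ('X - (y 0 i)%:P) ^+ p.-1)`_(a i)).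
apply/ffunP => x; rewrite sum_ffunE.
transitivity (\sum_y (u y : 'F_p) * (x == y)%:R).
  rewrite (bigD1 x) //= eqxx mulr1 big1 ?addr0 // => y yx.
  by rewrite eq_sym (negPf yx) mulr0.
under eq_bigr => y _ do rewrite -monom_fun_indicator mulr_sumr.
rewrite exchange_big; apply: eq_bigr => a _.
rewrite [RHS]ffunE [RHS]mulr_suml; apply: eq_bigr => y _.
by rewrite mulrA.
Qed.

(** The whole space [Ln] has one dimension per exponent vector, and dropping the monomials of degree
    above [d] loses at most their number. *)
Lemma card_exp_le_dim (d : nat) : (#|exp_le d| <= \dim (Lnd p n d))%N.
Proof.
have := @leq_dim_span_filter _ (Ln p n) _ (@Ln_monom p n) (exp_le d).
rewrite dimvf /dim /= -(cardC (exp_le d)) leq_add2r; apply=> u.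
exists (fun a => (u : {mpoly 'F_p[n]})@_(Ln_exp a)); apply: val_inj.
rewrite raddf_sum [LHS](Ln_expand (valP u)).
by apply: eq_bigr => a _.
Qed.

(** * Rank of the matrix with entries [f (a i + b j)] *)

Section AdditionMatrix.

Variables (k d : nat) (a b : 'I_k -> V).

Definition add_mx (f : FV) : 'M['F_p]_k := \matrix_(i, j) f (a i + b j).

Definition eval_mx (c : 'I_k -> V) : 'M['F_p]_(k, #|exp_le d|) :=
  \matrix_(i, e) monom_fun (enum_val e) (c i).

(* Each summand has rank at most [#|exp_le d|]: its left (resp. right) factor
   consists of the values of the monomials of degree at most [d]. *)
Definition split_mx (M : 'M['F_p]_k) : Prop :=
  exists L R, M = eval_mx a *m L + R *m (eval_mx b)^T.

Lemma split_mx0 : split_mx 0.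
Proof. by exists 0, 0; rewrite mulmx0 mul0mx addr0. Qed.

Lemma split_mxD M N : split_mx M -> split_mx N -> split_mx (M + N).
Proof.
move=> [L [R ->]] [L' [R' ->]]; exists (L + L'), (R + R').
by rewrite mulmxDr mulmxDl addrACA.
Qed.

Lemma split_mxZ c M : split_mx M -> split_mx (c *: M).
Proof.
move=> [L [R ->]]; exists (c *: L), (c *: R).
by rewrite scalerDr -scalemxAr -scalemxAl.
Qed.

Lemma split_mx_rank M : split_mx M -> (\rank M <= 2 * #|exp_le d|)%N.
Proof.
move=> [L [R ->]]; apply: leq_trans (mxrank_add _ _) _.
rewrite mul2n -addnn leq_add //.
  exact: leq_trans (mxrankM_maxl _ _) (rank_leq_col _).
exact: leq_trans (mxrankM_maxr _ _) (rank_leq_row _).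
Qed.

Lemma split_mx_monom (e1 e2 : exps) : exp_le d e1 || exp_le d e2 ->
  split_mx (\matrix_(i, j) (monom_fun e1 (a i) * monom_fun e2 (b j))).
Proof.
case/orP => e_le.
  pose r := enum_rank_in e_le e1.
  exists (\matrix_(t, j) ((t == r)%:R * monom_fun e2 (b j))), 0.
  rewrite mul0mx addr0; apply/matrixP => i j; rewrite !mxE (bigD1 r) //=.
  rewrite !mxE eqxx enum_rankK_in // mul1r big1 ?addr0 // => t /negPf tr.
  by rewrite !mxE tr mul0r mulr0.
pose r := enum_rank_in e_le e2.
exists 0, (\matrix_(i, t) (monom_fun e1 (a i) * (t == r)%:R)).
rewrite mulmx0 add0r; apply/matrixP => i j; rewrite !mxE (bigD1 r) //=.
rewrite !mxE eqxx enum_rankK_in // mulr1 big1 ?addr0 // => t /negPf tr.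
by rewrite !mxE tr mulr0 mul0r.
Qed.

(** The binomial theorem in each coordinate writes the monomial at [x + y] as a sum of products of a
    monomial in [x] and one in [y]. *)
Lemma split_add_mx_monom (e : exps) : exp_le d.*2.+1 e ->
  split_mx (add_mx (monom_fun e)).
Proof.
(* Truncated subtraction makes [diff h] an exponent vector for every [h]; when [h] is not below [e],
   a binomial coefficient is 0 and kills the term. *)
move=> e_le; pose diff (h : exps) : exps :=
  [ffun i => Ordinal (leq_ltn_trans (leq_subr (h i) (e i)) (ltn_ord (e i)))].
have -> : add_mx (monom_fun e) = \sum_(h : exps) (\prod_i 'C(e i, h i)%:R) *:
    \matrix_(i, j) (monom_fun (diff h) (a i) * monom_fun h (b j)).
  apply/matrixP => i j; rewrite summxE !mxE ffunE.
  transitivity (\prod_l \sum_(t < p)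
      ('C(e l, t)%:R * (a i 0 l ^+ (e l - t) * b j 0 l ^+ t))).
    apply: eq_bigr => l _; rewrite !mxE exprDn.
    (* Widening gives all coordinates the same range, as distributing the product over the sums
       requires. *)
    rewrite (big_ord_widen p (fun t => _ ^+ (e l - t) * _ ^+ t *+ 'C(e l, t))) //.
    rewrite big_mkcond; apply: eq_bigr => t _; rewrite mulr_natl.
    by case: ltnP => // lt_et; rewrite bin_small.
  rewrite bigA_distr_bigA; apply: eq_bigr => h _.
  rewrite !mxE !ffunE !big_split /=; congr (_ * (_ * _)).
  by apply: eq_bigr => l _; rewrite ffunE.
apply: (big_ind split_mx split_mx0 split_mxD) => h _.
have [/forallP he|] := boolP [forall i, (h i <= e i)%N]; last first.
  rewrite negb_forall => /existsP[i]; rewrite -ltnNge => lt_eh.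
  by rewrite (bigD1 i) //= bin_small // mul0r scale0r; apply: split_mx0.
apply/split_mxZ/split_mx_monom; move: e_le.
rewrite /exp_le /= !mdeg_Ln_exp.
have : (\sum_i diff h i + \sum_i h i = \sum_i e i)%N.
  by rewrite -big_split; apply: eq_bigr => i _; rewrite ffunE /= subnK.
move=> <-; rewrite -addnn; apply: contraTT.
(* If both degrees exceeded [d], their sum would be at least [2d + 2]. *)
rewrite negb_or -!ltnNge => /andP[lt1 lt2].
by rewrite -addnS -addSn leq_add.
Qed.

Lemma rank_add_mx (f : FV) :
    f \in <<[seq monom_fun e | e <- enum exps & exp_le d.*2.+1 e]>>%VS ->
  (\rank (add_mx f) <= 2 * #|exp_le d|)%N.
Proof.
set B := map _ _ => fB; apply: split_mx_rank.
have -> : add_mx f = \sum_(i < size B) coord (in_tuple B) i f *: add_mx B`_i.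
  apply/matrixP => i j; rewrite {1}(coord_span (fB : f \in <<in_tuple B>>%VS)).
  rewrite summxE !mxE sum_ffunE; apply: eq_bigr => l _.
  by rewrite !mxE !ffunE.
apply: (big_ind split_mx split_mx0 split_mxD) => i _; apply: split_mxZ.
have /mapP[e + ->] := mem_nth 0 (ltn_ord i).
by rewrite mem_filter => /andP[e_le _]; apply: split_add_mx_monom.
Qed.

End AdditionMatrix.

End MonomialFunctions.

(** * Application to perfectly matched sequences *)

Lemma perfectly_matched_support (p n m d : nat)
    (s : 'I_m -> 'rV['F_p]_n * 'rV['F_p]_n)
    (f : {ffun 'rV['F_p]_n -> ('F_p)^o}) :
    perfectly_matched s ->
    f \in <<[seq monom_fun e |
      e <- enum {ffun 'I_n -> 'I_p} & exp_le d.*2.+1 e]>>%VS ->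
    f \in fvanish (~: target_set s) ->
  (#|[set x | f x != 0%R]| <= 2 * #|@exp_le p n d|)%N.
Proof.
move=> s_matched f_le /fvanishP f0; set S := [set x | _].
have f_supp x : f x != 0 -> x \in target_set s.
  by apply: contraR => xT; rewrite f0 // inE.
have sel (j : 'I_#|S|) : exists i, (s i).1 + (s i).2 = enum_val j.
  have := enum_valP j; rewrite inE => /f_supp/imsetP[i _ ->].
  by exists i.
(* Each support point lies in the target set; [t] picks one pair summing to it. *)
have [t tP] := fin_all_exists sel.
have := rank_add_mx (fun j => (s (t j)).1) (fun j => (s (t j)).2) f_le.
apply: leq_trans; apply/eq_leq/esym.
set M := add_mx _ _ _.
have -> : M = diag_mx (\row_j f (enum_val j)).
  apply/matrixP => i j; rewrite !mxE.
  have [<-|ij] := eqVneq i j; first by rewrite tP mulr1n.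
  rewrite mulr0n; apply/eqP; apply: contraNT ij.
  (* A nonzero entry at [(i, j)] makes [a_(t i) + b_(t j)] a target [a_l + b_l], so matching forces
     [t i = t j]. *)
  case/f_supp/imsetP => l _ /esym/s_matched tij.
  by rewrite -(inj_eq enum_val_inj) -!tP tij.
apply/mxrank_unit; rewrite unitmxE det_diag unitfE.
by apply/prodf_neq0 => j _; rewrite mxE; have := enum_valP j; rewrite inE.
Qed.

Local Close Scope ring_scope.

Theorem theorem1 (p n m : nat) (s : 'I_m -> 'rV['F_p]_n * 'rV['F_p]_n)
    (p_prime : prime p) (n_ge1 : 1 <= n)
    (s_matched : perfectly_matched s) :
  #|target_set s| <= 3 * \dim (Lnd p n ((p - 1) * n %/ 3)).
Proof.
set d := _ %/ 3; set T := target_set s.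
apply: (@leq_trans (3 * #|@exp_le p n d|)); last first.
  by rewrite leq_mul2l card_exp_le_dim.
set U := <<[seq @monom_fun p n e |
  e <- enum {ffun 'I_n -> 'I_p} & exp_le d.*2.+1 e]>>%VS.
have le_U : #|{: 'rV['F_p]_n}| <=
    \dim U + #|[pred a | ~~ @exp_le p n d.*2.+1 a]|.
  rewrite -(dim_fullv_ffun 'F_p).
  exact: leq_dim_span_filter (exp_le d.*2.+1) (monom_fun_span p_prime).
have le_UT := leq_dim_fvanish U (~: T).
have [f] := large_support (U :&: fvanish (~: T)).
rewrite memv_cap => /andP[fU fT] le_f.
have le_supp := perfectly_matched_support s_matched fU fT.
have le_gt : #|[pred a | ~~ @exp_le p n d.*2.+1 a]| <= #|@exp_le p n d|.
  (* Rounding down loses at most 2, so [(p - 1) * n <= 3d + 2 = d + (2d + 1).+1]. *)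
  by apply: card_exp_gt_le; rewrite /d; lia.
(* Adding the complement of [T] to both sides turns the left side into the number of points of
   F_p^n, bounded by [le_U]. *)
rewrite -(leq_add2r #|~: T|) cardsC; apply: leq_trans le_U _.
apply: leq_trans (leq_add le_UT le_gt) _.
rewrite addnAC leq_add2r mulSn addnC leq_add2l.
exact: leq_trans le_f le_supp.
Qed.
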